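(* Let $x,y$ be roots of unity and $p,q\ge1$ integers with $(p,y)\neq(1,1)$ and $(q,xy)\ne(1,1)$. Then \begin{align*} &x\,T_{p;q}\big(y;(xy)^{-1}\big)-(-1)^{p+q}T_{p;q}\big(y^{-1};xy\big)\\ &=x\,\mathrm{ti}_p(y)\,\mathrm{ti}_q\big((xy)^{-1}\big)+(-1)^q y^{-1}\,\mathrm{ti}_p(y)\,\mathrm{ti}_q(xy)+(-1)^{p+q-1}\mathrm{ti}_{p+q}(x)\\ &\quad+(-1)^q\sum_{m=0}^{p-1}\binom{p+q-m-2}{q-1}\Big((-1)^m\mathrm{ti}_{m+1}(x)-x\,\mathrm{ti}_{m+1}\big(x^{-1}\big)\Big)\mathrm{Li}_{p+q-m-1}(xy)\\ &\quad+(-1)^q\sum_{m=0}^{q-1}\binom{p+q-m-2}{p-1}\Big((-1)^m x\,\mathrm{ti}_{m+1}\big(x^{-1}\big)-\mathrm{ti}_{m+1}(x)\Big)\mathrm{Li}_{p+q-m-1}(y). \end{align*}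
   Context: For a positive integer $p$ and a root of unity $z$: $t_n(p;z):=\sum_{k=1}^n\frac{z^k}{(k-1/2)^p}$; for $(p,z)\ne(1,1)$, $\mathrm{ti}_p(z):=\sum_{n=1}^\infty\frac{z^n}{(n-1/2)^p}$ and $\mathrm{Li}_p(z):=\sum_{n=1}^\infty\frac{z^n}{n^p}$. For positive integers $p,q$ and roots of unity $z,w$ with $(q,w)\ne(1,1)$, the linear cyclotomic Euler $T$-sum is $T_{p;q}(z;w):=\sum_{n=1}^\infty\frac{t_n(p;z)}{(n-1/2)^q}w^n$. Convention when $x=1$: the ($m=0$) expressions $\mathrm{ti}_1(x)-x\,\mathrm{ti}_1(x^{-1})$ and $x\,\mathrm{ti}_1(x^{-1})-\mathrm{ti}_1(x)$ are read as $0$, and each term containing such a factor is $0$. *)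

(* Defs.v *)
From mathcomp Require Import all_boot all_order all_algebra.
From mathcomp Require Import all_classical all_reals all_analysis.
From mathcomp Require Export complex.
Import Order.TTheory GRing.Theory Num.Theory.
Import numFieldNormedType.Exports.

Set Implicit Arguments.
Unset Strict Implicit.
Unset Printing Implicit Defensive.

Local Open Scope classical_set_scope.
Local Open Scope ring_scope.
Local Open Scope complex_scope.

(* The limit of the partial sums in the norm topology of K, so that
   conditionally convergent series are covered; unspecified if they diverge. *)
Definition sum_from1 (K : numFieldType) (u : nat -> K) : K :=
  limn (fun N => \sum_(1 <= n < N.+1) u n).

Section CyclotomicEulerTSums.
Context {R : realType}.
Implicit Types (x y z w : R[i]) (p q n m : nat).

(* The bound 0 < n matters: every element is a 0-th root of unity. *)
Definition some_unity_root z : Prop := exists2 n, (0 < n)%N & n.-unity_root z.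

Definition t_sum n p z : R[i] :=
  \sum_(1 <= k < n.+1) z ^+ k / (k%:R - 2^-1) ^+ p.

Definition ti p z : R[i] :=
  sum_from1 (fun n => z ^+ n / (n%:R - 2^-1) ^+ p).

Definition Li p z : R[i] :=
  sum_from1 (fun n => z ^+ n / n%:R ^+ p).

Definition T_sum p q z w : R[i] :=
  sum_from1 (fun n => t_sum n p z / (n%:R - 2^-1) ^+ q * w ^+ n).

(* (-1)^m ti_{m+1}(x) - x ti_{m+1}(x^-1), read as 0 when m = 0 and x = 1,
   where ti_1(1) diverges. *)
Definition ti_diff m x : R[i] :=
  if (m == 0%N) && (x == 1) then 0
  else (-1) ^+ m * ti m.+1 x - x * ti m.+1 x^-1.

(* (-1)^m x ti_{m+1}(x^-1) - ti_{m+1}(x), with the same convention. *)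
Definition ti_diffV m x : R[i] :=
  if (m == 0%N) && (x == 1) then 0
  else (-1) ^+ m * x * ti m.+1 x^-1 - ti m.+1 x.

End CyclotomicEulerTSums.

(* Main.v *)
Require Import Defs.
From mathcomp Require Import all_boot all_order all_algebra.
From mathcomp Require Import all_classical all_reals all_analysis complex.
From mathcomp Require Import ring zify.
Import Order.TTheory GRing.Theory Num.Theory.
Import numFieldNormedType.Exports.
Local Open Scope ring_scope.
Local Open Scope complex_scope.

Set Implicit Arguments.
Unset Strict Implicit.
Unset Printing Implicit Defensive.

(** Write [a_n = n - 1/2] for every integer [n], so that [a_(1-n) = - a_n].  The
    theorem evaluates in two ways the double sum over integers [n < l] of

      [y^(-n) (x y)^l / ((- a_n)^p (a_l)^q)].

    On the one hand, the substitution [n -> 1 - n] brings negative indices back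
    to positive ones.  The part [0 < n < l] is [T_sum p q y^-1 (x y)] without
    its diagonal [ti (p + q) x], the part [n <= 0 < l] is a product of two [ti],
    and the part [n < l <= 0] is a product of two [ti] minus
    [T_sum p q y (x y)^-1].

    On the other hand, [a_l - a_n = l - n] is a positive integer [k].  Expanding
    [1 / ((- a_n)^p (a_l)^q)] in partial fractions with respect to
    [(- a_n) + a_l = k] separates the variables: each term is a power of [1/k]
    times a power of [1/a_n] or of [1/a_l], with a binomial coefficient.  The
    sum over [k] becomes [Li], and the sum over the other index becomes the
    bilateral sum of [x^n / (a_n)^(m+1)], which is [(-1)^m ti_diff m x].

    Many of these series converge only conditionally, so everything is done
    with [1 - N <= n < l <= N].  Both evaluations are then finite identities
    ([window_sum_split], [window_sum_partial_fractions]), but in the second one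
    the sum over [k] is cut at a length that depends on the other index.  Two
    facts allow the passage to the limit.  The partial sums of [ti] and [Li]
    reach their limits at rate [O(1/n)], be it by summation by parts or by
    absolute convergence ([partial_sum_rate]).  And an error [O(1/n)], weighted
    by [1/|a_n|] over the window, contributes [O(H_N / N)], where [H_N] are the
    harmonic numbers ([window_convolution_tends]).  This treats all exponents
    and roots of unity uniformly. *)

(** * Partial fractions *)

(** The part carried by the powers of [a = 1/s] in the partial fraction
    expansion of [1 / (s^(p+1) t^(q+1))], where [c = 1/(s + t)].  Working with
    the inverses keeps every identity below inside a commutative ring. *)
Definition pf_half (K : comPzRingType) (c a : K) (p q : nat) : K :=
  \sum_(0 <= m < p.+1) 'C(p + q - m, q)%:R * (c ^+ (p + q - m).+1 * a ^+ m.+1).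

(** Pascal's rule; the extreme term [m = p + 1] comes from the second summand
    alone. *)
Lemma pf_halfS (K : comPzRingType) (c a : K) p q :
  pf_half c a p.+1 q.+1 = c * (pf_half c a p q.+1 + pf_half c a p.+1 q).
Proof.
rewrite /pf_half [in LHS]big_nat_recr // [in X in _ + X]big_nat_recr //=.
rewrite addrA mulrDr -big_split /= mulr_sumr; congr (_ + _).
  apply: eq_big_nat => m /andP[_ lt_mp].
  have -> : (p.+1 + q.+1 - m = (p + q.+1 - m).+1)%N by lia.
  have -> : (p.+1 + q - m = p + q.+1 - m)%N by lia.
  by rewrite binS natrD !exprS; ring.
rewrite !addKn !binn !exprS; ring.
Qed.

Lemma pf_half0r (K : comPzRingType) (c a : K) p :
  pf_half c a p.+1 0 = c * pf_half c a p 0 + c * a ^+ p.+2.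
Proof.
rewrite /pf_half big_nat_recr //= addKn bin0 mulr_sumr; congr (_ + _); last by ring.
apply: eq_big_nat => m /andP[_ lt_mp].
have -> : (p.+1 + 0 - m = (p + 0 - m).+1)%N by lia.
by rewrite !bin0 !exprS; ring.
Qed.

Lemma pf_half0l (K : comPzRingType) (c a : K) q :
  pf_half c a 0 q = c ^+ q.+1 * a.
Proof. by rewrite /pf_half big_nat1 add0n subn0 binn mul1r. Qed.

(** The hypothesis is [1/(s t) = (1/s + 1/t) / (s + t)].  Applied once, it
    writes the [(p, q)] product through the [(p - 1, q)] and [(p, q - 1)] ones,
    and both expansions obey the same recurrence. *)
Lemma partial_fractions (K : comPzRingType) (a b c : K) p q :
  a * b = c * (a + b) ->
  a ^+ p.+1 * b ^+ q.+1 = pf_half c a p q + pf_half c b q p.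
Proof.
move=> abc.
have base q' a' b' : a' * b' = c * (a' + b') ->
    a' * b' ^+ q'.+1 = pf_half c a' 0 q' + pf_half c b' q' 0.
  move=> abc'; elim: q' => [|q' IH].
    by rewrite !pf_half0l abc'; ring.
  rewrite pf_half0r exprS mulrA abc' -mulrA mulrDl IH !pf_half0l !exprS; ring.
elim: p q => [|p IHp] q; first by rewrite base.
elim: q => [|q IHq].
  by rewrite mulrC base 1?addrC // mulrC abc addrC.
rewrite !pf_halfS -!mulrDr [pf_half c b q p.+1 + _]addrC addrACA -IHp -IHq.
transitivity (a ^+ p.+1 * b ^+ q.+1 * (a * b)); first by rewrite !exprS; ring.
by rewrite abc !exprS; ring.
Qed.

(** * Half-odd integers and symmetric windows *)

Definition half_odd (K : numFieldType) (n : int) : K := n%:~R - 2^-1.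

(** The shift [c] is [1/2] for the series [ti] and [0] for [Li]. *)
Definition partial_sum (K : numFieldType) (c : K) (p : nat) (z : K) (n : nat) : K :=
  \sum_(1 <= k < n.+1) z ^+ k / (k%:R - c) ^+ p.

(** The integers [n] with [1 - N <= n <= N], listed by [0 <= i < 2N].  This
    window is stable under [n -> 1 - n], which negates [half_odd n]. *)
Definition window (N i : nat) : int := i%:Z + 1 - N%:Z.

Lemma half_odd_neq0 (K : numFieldType) (n : int) : half_odd K n != 0.
Proof.
rewrite /half_odd subr_eq0; apply/eqP => e.
have : (2 * n)%:~R = 1%:~R :> K by rewrite intrM e mulfV ?pnatr_eq0.
by move/intr_inj; lia.
Qed.

Lemma half_oddS (K : numFieldType) (i : nat) :
  half_odd K i.+1 = i.+1%:R - 2^-1.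
Proof. by []. Qed.

Lemma half_oddC (K : numFieldType) (n : int) :
  half_odd K (1 - n) = - half_odd K n.
Proof. by rewrite /half_odd rmorphB /=; field. Qed.

Lemma half_oddN (K : numFieldType) (i : nat) :
  half_odd K (- i%:Z) = - (i.+1%:R - 2^-1).
Proof. by rewrite -half_oddS -half_oddC; congr half_odd; lia. Qed.

Lemma big_window (V : nmodType) (F : int -> V) (N : nat) :
  \sum_(0 <= i < N + N) F (window N i)
  = \sum_(0 <= i < N) (F i.+1 + F (- i%:Z)).
Proof.
rewrite (big_cat_nat (n := N)) ?leq_addr //= addrC big_split /=; congr (_ + _).
  rewrite -{1}[N]add0n big_addn addnK.
  by apply: eq_bigr => i _; congr F; rewrite /window; lia.
rewrite big_nat_rev /=; apply: eq_big_nat => i /andP[_ lt_iN].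
by congr F; rewrite /window; lia.
Qed.

(** Summing a function of the gap [j - i] over all [j] to the right of [i] gives
    a partial sum whose length depends on [i] only; likewise on the left. *)
Lemma sum_gap_right (V : nmodType) (f : nat -> V) M i : (i < M)%N ->
  \sum_(0 <= j < M | (i < j)%N) f (j - i)%N = \sum_(1 <= k < (M.-1 - i).+1) f k.
Proof.
move=> lt_iM; rewrite (big_cat_nat (n := i.+1)) //=.
rewrite big_nat_cond big_pred0 ?add0r; last first.
  by move=> j; apply/negbTE; lia.
rewrite -{1}[i.+1]addn1 addnC big_addn.
rewrite (_ : (M - i)%N = (M.-1 - i).+1); last by lia.
rewrite big_nat_cond [RHS]big_nat_cond.
by apply: eq_big => [j|j _]; rewrite ?addnK //; lia.
Qed.

Lemma sum_gap_left (V : nmodType) (f : nat -> V) M j : (j < M)%N ->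
  \sum_(0 <= i < M | (i < j)%N) f (j - i)%N = \sum_(1 <= k < j.+1) f k.
Proof.
move=> lt_jM; rewrite (big_cat_nat (n := j)) ?(ltnW lt_jM) //=.
rewrite [X in _ + X]big_nat_cond [X in _ + X]big_pred0 ?addr0; last first.
  by move=> i; apply/negbTE; lia.
rewrite big_nat_rev big_add1 /= big_nat_cond [RHS]big_nat_cond.
by apply: eq_big => [i|i]; [lia | move=> ?; congr f; lia].
Qed.

(** * The finite double sum and its two evaluations *)

(** The finite double sum that is computed in two ways: over [n < l] in the
    window, it collects [y^(-n) (x y)^l / ((- half_odd n)^p (half_odd l)^q)]. *)
Definition window_sum (K : numFieldType) (p q : nat) (x y : K) (N : nat) : K :=
  \sum_(0 <= i < N + N) \sum_(0 <= j < N + N | (i < j)%N)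
    y ^ (- window N i) * (x * y) ^ window N j
    / ((- half_odd K (window N i)) ^+ p * half_odd K (window N j) ^+ q).

(** Since [half_odd l - half_odd n = l - n] is a positive integer [k], partial
    fractions separate [k] from one of the two indices: the numerator is
    [x^n (x y)^k] as well as [x^l y^k].  The inner sums over [k] are partial
    sums of [Li], of a length that depends on the outer index. *)
Lemma window_sum_partial_fractions (K : numFieldType) (p q : nat) (x y : K) N :
  x != 0 -> y != 0 ->
  window_sum p.+1 q.+1 x y N =
    \sum_(0 <= m < p.+1) 'C(p + q - m, q)%:R *
      \sum_(0 <= i < N + N) x ^ window N i / (- half_odd K (window N i)) ^+ m.+1
        * partial_sum 0 (p + q - m).+1 (x * y) ((N + N).-1 - i)
  + \sum_(0 <= m < q.+1) 'C(p + q - m, p)%:R *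
      \sum_(0 <= j < N + N) x ^ window N j / half_odd K (window N j) ^+ m.+1
        * partial_sum 0 (p + q - m).+1 y j.
Proof.
move=> x0 y0.
pose h i := half_odd K (window N i).
have h0 i : h i != 0 by apply: half_odd_neq0.
have term i j : (i < j)%N ->
    y ^ (- window N i) * (x * y) ^ window N j / ((- h i) ^+ p.+1 * h j ^+ q.+1)
  = \sum_(0 <= m < p.+1) 'C(p + q - m, q)%:R * (x ^ window N i / (- h i) ^+ m.+1
        * ((x * y) ^+ (j - i) / (j - i)%:R ^+ (p + q - m).+1))
  + \sum_(0 <= m < q.+1) 'C(p + q - m, p)%:R * (x ^ window N j / h j ^+ m.+1
        * (y ^+ (j - i) / (j - i)%:R ^+ (p + q - m).+1)).
  move=> lt_ij.
  have ew : window N j = window N i + (j - i)%:Z by rewrite /window; lia.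
  have hji : h j - h i = (j - i)%:R.
    by rewrite /h /half_odd ew rmorphD /=; ring.
  have c0 : (j - i)%:R != 0 :> K by rewrite pnatr_eq0; lia.
  have xy0 : x * y != 0 by rewrite mulf_neq0.
  have e1 : y ^ (- window N i) * (x * y) ^ window N j
          = x ^ window N i * (x * y) ^+ (j - i).
    rewrite ew; move: (window N i) => n; rewrite expfzDr // expfzMl -invr_expz -exprnP.
    set u := y ^ _; set v := _ ^+ (j - i); set w := x ^ _.
    by field; rewrite expfz_neq0.
  have e2 : x ^ window N i * (x * y) ^+ (j - i) = x ^ window N j * y ^+ (j - i).
    rewrite ew; move: (window N i) => n.
    by rewrite expfzDr // -exprnP exprMn mulrA.
  rewrite invfM -!exprVn (@partial_fractions _ _ _ (j - i)%:R^-1); last first.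
    rewrite -hji; field.
    by rewrite !h0 hji.
  rewrite mulrDr {2}e1 e2 e1 /pf_half !mulr_sumr.
  congr (_ + _); apply: eq_bigr => m _.
    rewrite -!exprVn; set u := x ^ _; set v := (x * y) ^+ _; ring.
  rewrite -!exprVn [(q + p)%N]addnC; set u := x ^ _; set v := y ^+ _; ring.
transitivity (\sum_(0 <= i < N + N) \sum_(0 <= j < N + N | (i < j)%N)
   (\sum_(0 <= m < p.+1) 'C(p + q - m, q)%:R * (x ^ window N i / (- h i) ^+ m.+1
        * ((x * y) ^+ (j - i) / (j - i)%:R ^+ (p + q - m).+1))
  + \sum_(0 <= m < q.+1) 'C(p + q - m, p)%:R * (x ^ window N j / h j ^+ m.+1
        * (y ^+ (j - i) / (j - i)%:R ^+ (p + q - m).+1)))).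
  by apply: eq_bigr => i _; apply: eq_bigr => j lt_ij; rewrite term.
under eq_bigr do rewrite big_split /=.
rewrite big_split /=; congr (_ + _).
  under eq_bigr do rewrite exchange_big /=.
  rewrite exchange_big /=; apply: eq_bigr => m _.
  rewrite mulr_sumr; apply: eq_big_nat => i /andP[_ lt_i].
  under eq_bigr do rewrite mulrA.
  rewrite -mulr_sumr -[LHS]mulrA; congr (_ * (_ * _)).
  apply: etrans (sum_gap_right
    (fun k => (x * y) ^+ k / k%:R ^+ (p + q - m).+1) lt_i) _.
  by apply: eq_bigr => k _; rewrite subr0.
rewrite (exchange_big_dep_nat xpredT) //=.
under eq_bigr do rewrite exchange_big /=.
rewrite exchange_big /=; apply: eq_bigr => m _.
rewrite mulr_sumr; apply: eq_big_nat => j /andP[_ lt_j].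
under eq_bigr do rewrite mulrA.
rewrite -mulr_sumr -[LHS]mulrA; congr (_ * (_ * _)).
apply: etrans (sum_gap_left
  (fun k => y ^+ k / k%:R ^+ (p + q - m).+1) lt_j) _.
by apply: eq_bigr => k _; rewrite subr0.
Qed.

Definition T_partial_sum (K : numFieldType) (p q : nat) (z w : K) (N : nat) : K :=
  \sum_(1 <= n < N.+1) partial_sum 2^-1 p z n / (n%:R - 2^-1) ^+ q * w ^+ n.

Lemma inv_sign_pow (K : fieldType) n : ((-1) ^+ n)^-1 = (-1) ^+ n :> K.
Proof. by rewrite -exprVn invrN1. Qed.

Lemma partial_sum_shift (K : numFieldType) (c : K) p z N :
  partial_sum c p z N = \sum_(0 <= i < N) z ^+ i.+1 / (i.+1%:R - c) ^+ p.
Proof. by rewrite /partial_sum big_add1. Qed.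

Lemma T_partial_sum_triangle (K : numFieldType) (p q : nat) (z w : K) N :
  T_partial_sum p q z w N = \sum_(0 <= i < N) \sum_(0 <= j < N)
    if (i <= j)%N then z ^+ i.+1 / half_odd K i.+1 ^+ p
                       * (w ^+ j.+1 / half_odd K j.+1 ^+ q) else 0.
Proof.
rewrite exchange_big /= /T_partial_sum big_add1 /=; apply: eq_big_nat => j /andP[_ lt_j].
rewrite -big_mkcond /= (big_cat_nat (n := j.+1)) //=.
rewrite [X in _ = _ + X]big_nat_cond [X in _ = _ + X]big_pred0 ?addr0; last first.
  by move=> i; apply/negbTE; lia.
rewrite partial_sum_shift !mulr_suml [LHS]big_nat_cond [RHS]big_nat_cond.
apply: eq_big => [i|i _]; first by lia.
by rewrite !half_oddS mulrAC -!mulrA.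
Qed.

(** Splitting [n < l] by the signs of [n] and [l], with [n = 1 - n'] for
    [n <= 0].  For [0 < n < l] one gets the triangle of [T_sum] without its
    diagonal, for [n <= 0 < l] a full square, and for [n < l <= 0] the square
    minus a triangle. *)
Lemma window_sum_split (K : numFieldType) (p q : nat) (x y : K) N :
  x != 0 -> y != 0 ->
  window_sum p q x y N =
    (-1) ^+ p * (T_partial_sum p q y^-1 (x * y) N - partial_sum 2^-1 (p + q) x N)
  + y^-1 * (partial_sum 2^-1 p y N * partial_sum 2^-1 q (x * y) N)
  + (-1) ^+ q * x * (partial_sum 2^-1 p y N * partial_sum 2^-1 q (x * y)^-1 N
                     - T_partial_sum p q y (x * y)^-1 N).
Proof.
move=> x0 y0; have xy0 : x * y != 0 by rewrite mulf_neq0.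
pose G n l : K := y ^ (- n) * (x * y) ^ l
  / ((- half_odd K n) ^+ p * half_odd K l ^+ q).
pose H (n l : int) : K := if (n < l)%R then G n l else 0.
pose f z r i : K := z ^+ i.+1 / half_odd K i.+1 ^+ r.
have -> : window_sum p q x y N =
    \sum_(0 <= i < N) \sum_(0 <= j < N)
      ((H i.+1 j.+1 + H i.+1 (- j%:Z)) + (H (- i%:Z) j.+1 + H (- i%:Z) (- j%:Z))).
  rewrite /window_sum.
  transitivity (\sum_(0 <= i < N + N) \sum_(0 <= j < N + N)
                   H (window N i) (window N j)).
    apply: eq_bigr => i _; rewrite [LHS]big_mkcond; apply: eq_bigr => j _.
    by rewrite /H; congr (if _ then _ else _); rewrite /window; lia.
  under eq_bigr do rewrite big_window.
  rewrite (big_window (fun n => \sum_(0 <= j < N) (H n j.+1 + H n (- j%:Z)))).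
  by apply: eq_bigr => i _; rewrite -big_split.
have a0 i : half_odd K i != 0 by apply: half_odd_neq0.
have Hpp i j : H i.+1 j.+1 = (-1) ^+ p *
    ((if (i <= j)%N then f y^-1 p i * f (x * y) q j else 0)
     - (if i == j then f x (p + q)%N i else 0)).
  rewrite /H (_ : (i.+1%:Z < j.+1) = (i < j)%N) //.
  have e : G i.+1 j.+1 = (-1) ^+ p * (f y^-1 p i * f (x * y) q j).
    rewrite /G /f -exprnP -exprz_inv -exprnP [(- half_odd _ _) ^+ p]exprNn.
    rewrite !invfM inv_sign_pow.
    by rewrite -!mulrA; ring.
  case: (ltngtP i j) => [_|_|<-]; rewrite ?e ?subr0 ?subrr ?mulr0 //.
  rewrite (_ : f y^-1 p i * _ = f x (p + q)%N i) ?subrr ?mulr0 //.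
  rewrite /f exprD exprMn exprVn; set u := y ^+ _; set v := x ^+ _.
  set t := half_odd _ _.
  by field; rewrite !expf_neq0 ?a0.
have Hpn i j : H i.+1 (- j%:Z) = 0.
  by rewrite /H; case: ifP => //; lia.
have Hnp i j : H (- i%:Z) j.+1 = y^-1 * (f y p i * f (x * y) q j).
  rewrite /H (_ : (- i%:Z < j.+1)) ?lez_nat; last by lia.
  rewrite /G /f half_oddN -half_oddS !opprK -!exprnP.
  rewrite [y ^+ i.+1]exprS; set u := y ^+ i; set v := (x * y) ^+ _.
  set s := half_odd _ _; set t := half_odd _ _.
  by field; rewrite y0 !expf_neq0 ?a0.
have Hnn i j : H (- i%:Z) (- j%:Z) = (-1) ^+ q * x *
    (f y p i * f (x * y)^-1 q j
     - (if (i <= j)%N then f y p i * f (x * y)^-1 q j else 0)).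
  rewrite /H (_ : (- i%:Z < - j%:Z) = ~~ (i <= j)%N); last by lia.
  case: leqP => _ /=; rewrite ?subrr ?mulr0 // subr0.
  rewrite /G /f !half_oddN -!half_oddS !opprK -exprz_inv -!exprnP.
  rewrite [(- half_odd _ _) ^+ q]exprNn [y ^+ _.+1]exprS [(x * y)^-1 ^+ _.+1]exprS.
  set u := y ^+ i; set v := _^-1 ^+ j.
  rewrite !invfM inv_sign_pow; set s := half_odd _ _; set t := half_odd _ _.
  by field; rewrite x0 y0 !expf_neq0 ?a0.
transitivity (\sum_(0 <= i < N) \sum_(0 <= j < N) (
   ((-1) ^+ p * ((if (i <= j)%N then f y^-1 p i * f (x * y) q j else 0)
     - (if i == j then f x (p + q)%N i else 0)) + y^-1 * (f y p i * f (x * y) q j))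
  + (-1) ^+ q * x * (f y p i * f (x * y)^-1 q j
     - (if (i <= j)%N then f y p i * f (x * y)^-1 q j else 0)))).
  by apply: eq_bigr => i _; apply: eq_bigr => j _; rewrite Hpp Hpn Hnp Hnn addr0 addrA.
have prod z w : partial_sum 2^-1 p z N * partial_sum 2^-1 q w N
    = \sum_(0 <= i < N) \sum_(0 <= j < N) f z p i * f w q j.
  by rewrite !partial_sum_shift mulr_suml; apply: eq_bigr => i _; rewrite mulr_sumr.
have diag : partial_sum 2^-1 (p + q) x N
    = \sum_(0 <= i < N) \sum_(0 <= j < N) if i == j then f x (p + q)%N i else 0.
  rewrite partial_sum_shift; apply: eq_big_nat => i /= lt_i.
  rewrite (bigD1_seq i) ?iota_uniq ?mem_index_iota //= eqxx big1 ?addr0 // => j.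
  by rewrite eq_sym => /negbTE->.
rewrite !prod diag !T_partial_sum_triangle.
rewrite -!sumrB !mulr_sumr -!big_split /=; apply: eq_bigr => i _.
by rewrite -!sumrB !mulr_sumr -!big_split.
Qed.

Lemma window_powersum (K : numFieldType) m (x : K) N : x != 0 ->
  \sum_(0 <= i < N + N) x ^ window N i / half_odd K (window N i) ^+ m
  = partial_sum 2^-1 m x N + (-1) ^+ m * x * partial_sum 2^-1 m x^-1 N.
Proof.
move=> x0; rewrite (big_window (fun n => x ^ n / half_odd K n ^+ m)) big_split /=.
rewrite !partial_sum_shift mulr_sumr; congr (_ + _); apply: eq_bigr => i _.
rewrite half_oddN -half_oddS [(- half_odd _ _) ^+ m]exprNn invfM inv_sign_pow.
rewrite -exprz_inv -exprnP [in RHS]exprS.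
set u := x^-1 ^+ i; set s := _ ^+ m; set t := (half_odd _ _ ^+ m)^-1.
by rewrite [u * _]mulrC; field.
Qed.

(** * Limits of sequences *)

(** The complex numbers are a topological space only through their numFieldType
    structure; taking the field as an argument lets it be found from [u]. *)
Definition tends (K : numFieldType) (u : nat -> K) (l : K) : Prop :=
  (u @ \oo --> l)%classic.

Lemma tendsP (K : numFieldType) (u : nat -> K) l : tends u l <->
  forall e, 0 < e -> exists N, forall n, (N <= n)%N -> `|u n - l| <= e.
Proof.
split=> [/cvgrPdist_le ul e e_gt0|ul].
  have [N _ uN] := ul e e_gt0.
  by exists N => n leNn; rewrite distrC; apply: uN.
apply/cvgrPdist_le => e e_gt0; have [N uN] := ul e e_gt0.
by exists N => // n /= leNn; rewrite distrC; apply: uN.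
Qed.

Lemma tendsD (K : numFieldType) (u v : nat -> K) a b :
  tends u a -> tends v b -> tends (fun n => u n + v n) (a + b).
Proof. exact: cvgD. Qed.

Lemma tendsM (K : numFieldType) (u v : nat -> K) a b :
  tends u a -> tends v b -> tends (fun n => u n * v n) (a * b).
Proof. exact: cvgM. Qed.

Lemma tends_cst (K : numFieldType) (a : K) : tends (fun=> a) a.
Proof. exact: cvg_cst. Qed.
Arguments tends_cst {K} a.

Lemma tends_unique (K : numFieldType) (u : nat -> K) a b :
  tends u a -> tends u b -> a = b.
Proof. exact: cvg_unique. Qed.

Lemma tends_eq (K : numFieldType) (u v : nat -> K) a :
  tends u a -> u =1 v -> tends v a.
Proof. by move=> ua /funext <-. Qed.

Lemma tendsZ (K : numFieldType) (c : K) (u : nat -> K) a :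
  tends u a -> tends (fun n => c * u n) (c * a).
Proof. exact/tendsM/tends_cst. Qed.
Arguments tendsZ {K} c {u a}.

Lemma tendsB (K : numFieldType) (u v : nat -> K) a b :
  tends u a -> tends v b -> tends (fun n => u n - v n) (a - b).
Proof. exact: cvgB. Qed.

Lemma tends_sum (K : numFieldType) (M : nat) (u : nat -> nat -> K) a :
  (forall m, (m < M)%N -> tends (u m) (a m)) ->
  tends (fun n => \sum_(0 <= m < M) u m n) (\sum_(0 <= m < M) a m).
Proof.
elim: M => [|M IH] ua.
  rewrite big_geq //. apply: (tends_eq (tends_cst 0)) => n /=.
  by rewrite big_geq.
rewrite big_nat_recr //=.
have IH' := IH (fun m lt_mM => ua m (ltnW lt_mM)).
apply: (tends_eq (tendsD IH' (ua M (ltnSn M)))) => n.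
by rewrite [RHS]big_nat_recr.
Qed.

Lemma sum_from1_tends (K : numFieldType) (u : nat -> K) l :
  tends (fun N => \sum_(1 <= n < N.+1) u n) l -> sum_from1 u = l.
Proof. by move=> /cvg_lim; apply; exact: norm_hausdorff. Qed.

Lemma tends_bound (R : realType) (u : nat -> R[i]) L C (h : nat -> R) :
  tends h 0 -> (forall n, `|u n - L| <= C * (h n)%:C) -> tends u L.
Proof.
move=> h0 uL; apply/tendsP => e e_gt0.
have [c ec] : exists c, e = c%:C by apply/complex_realP; exact: gtr0_real.
have c_gt0 : 0 < c by rewrite -ltcR -ec.
have [b Cb] : exists b, `|C| = b%:C by apply/complex_realP; exact: normr_real.
have b_ge0 : 0 <= b by rewrite -ler0c -Cb.
have d_gt0 : 0 < c / (b + 1) by rewrite divr_gt0 // ltr_wpDl.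
have /tendsP/(_ _ d_gt0)[N hN] := h0.
exists N => n leNn; apply: le_trans (uL n) _.
have := hN n leNn; rewrite subr0 => hn.
have : C * (h n)%:C <= `|C * (h n)%:C|.
  by apply: real_ler_norm; rewrite ger0_real // (le_trans (normr_ge0 _) (uL n)).
move=> /le_trans; apply; rewrite normrM Cb ec normc_def /= expr0n addr0 sqrtr_sqr.
rewrite -rmorphM lecR (le_trans (ler_wpM2l b_ge0 hn)) //.
by rewrite mulrA ler_pdivrMr ?ltr_wpDl // mulrC mulrDr mulr1 lerDl ltW.
Qed.

(** A Cauchy sequence with an explicit modulus keeps it as a rate of
    convergence: let [m] tend to infinity in the hypothesis. *)
Lemma real_cauchy_rate (R : realType) (v : nat -> R) (C : R) :
  (forall n m, (n <= m)%N -> `|v m - v n| <= C / n.+1%:R) ->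
  exists a, forall n, `|v n - a| <= C / n.+1%:R.
Proof.
move=> vC.
have rate0 : tends (fun n => C / n.+1%:R) 0.
  by rewrite -[X in tends _ X](mulr0 C); apply: tendsZ; exact: cvg_harmonic.
have : cvg (v @ \oo)%classic.
  apply: cauchy_cvg; apply: cauchy_exP => e /= e_gt0.
  have e2 : 0 < e / 2 by rewrite divr_gt0.
  have /tendsP/(_ _ e2)[N rN] := rate0.
  exists (v N); exists N => // n /= leNn; rewrite -ball_normE /= distrC.
  apply: le_lt_trans (vC _ _ leNn) _.
  have := rN N (leqnn N); rewrite subr0 => /(le_trans (ler_norm _)) h.
  by rewrite (le_lt_trans h) // ltr_pdivrMr // ltr_pMr // ltr1n.
move=> /cvg_ex[a va]; exists a => n.
apply/ler_addgt0Pl => e e_gt0.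
have /tendsP/(_ _ e_gt0)[N vN] := va.
have h1 := vN _ (leq_maxl N n); have h2 := vC _ _ (leq_maxr N n).
rewrite -(subrKA (v (maxn N n))) (le_trans (ler_normD _ _)) // addrC.
by rewrite lerD // distrC.
Qed.

Lemma normc_le_ReIm (R : realType) (z : R[i]) :
  `|z| <= `|complex.Re z|%:C + `|complex.Im z|%:C.
Proof.
rewrite {1}[z]complexE (le_trans (ler_normD _ _)) // normrM.
have -> : `|'i%C| = 1 :> R[i] by rewrite normc_def /= expr0n expr1n add0r sqrtr1.
by rewrite mul1r !normc_def /= expr0n !addr0 !sqrtr_sqr.
Qed.

Lemma normc_ge_Im (R : realType) (z : R[i]) : `|complex.Im z|%:C <= `|z|.
Proof.
rewrite normc_def lecR -sqrtr_sqr ler_wsqrtr // lerDr sqr_ge0 //.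
Qed.

(** Completeness of the complex numbers, through real and imaginary parts; only
    the shape [O(1/n)] of the rate matters, so the constant may double. *)
Lemma cauchy_rate (R : realType) (u : nat -> R[i]) (C : R[i]) :
  (forall n m, (n <= m)%N -> `|u m - u n| <= C / n.+1%:R) ->
  exists L D, forall n, `|u n - L| <= D / n.+1%:R.
Proof.
move=> uC.
have C_ge0 : 0 <= C.
  by have := uC 0%N 0%N (leqnn _); rewrite subrr normr0 divr1.
have [c Cc] : exists c, C = c%:C by apply/complex_realP; exact: ger0_real.
have div_c n : C / n.+1%:R = (c / n.+1%:R)%:C.
  by rewrite Cc rmorphM fmorphV rmorph_nat.
have [a ua] : exists a, forall n, `|complex.Re (u n) - a| <= c / n.+1%:R.
  apply: real_cauchy_rate => n m le_nm; rewrite -lecR -div_c.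
  by apply: le_trans (uC _ _ le_nm); rewrite -raddfB; exact: normc_ge_Re.
have [b ub] : exists b, forall n, `|complex.Im (u n) - b| <= c / n.+1%:R.
  apply: real_cauchy_rate => n m le_nm; rewrite -lecR -div_c.
  by apply: le_trans (uC _ _ le_nm); rewrite -raddfB; exact: normc_ge_Im.
exists (a +i* b)%C, (C + C) => n.
apply: le_trans (normc_le_ReIm _) _; rewrite mulrDl div_c.
by apply: lerD; rewrite lecR; [have := ua n | have := ub n]; case: (u n).
Qed.

(** * Rates of convergence *)

Lemma telescoping_bound (K : numFieldType) (u v : nat -> K) :
  (forall k, `|u k.+1 - u k| <= v k - v k.+1) ->
  forall n m, (n <= m)%N -> `|u m - u n| <= v n - v m.
Proof.
move=> uv n m /subnK <-; elim: (m - n)%N => [|k IH]; first by rewrite !subrr normr0.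
rewrite addSn -(subrKA (u (k + n)%N)) (le_trans (ler_normD _ _)) //.
by rewrite -(subrKA (v (k + n)%N) (v n)) addrC lerD.
Qed.

Lemma half_le_shift (K : numFieldType) (c : K) k :
  c <= 2^-1 -> 2^-1 * k.+1%:R <= k.+1%:R - c.
Proof.
move=> c_le; rewrite lerBrDr (le_trans (lerD (lexx _) c_le)) //.
rewrite -[X in _ + X]mulr1 -mulrDr natr1 ler_pdivrMl //.
by rewrite -natrM ler_nat; lia.
Qed.

(** For the shifts [c = 0] and [c = 1/2] alike, [k + 1 - c] is at least
    [(k + 1) / 2]. *)
Lemma inv_shift_pow (K : numFieldType) (c : K) p k : c <= 2^-1 ->
  0 < ((k.+1%:R - c) ^+ p)^-1 <= (2 / k.+1%:R) ^+ p.
Proof.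
move=> c_le; have le_k := half_le_shift k c_le.
have gt0 : 0 < 2^-1 * k.+1%:R :> K by rewrite mulr_gt0.
have gt0' := lt_le_trans gt0 le_k.
rewrite invr_gt0 exprn_gt0 //= -exprVn lerXn2r ?nnegrE ?invr_ge0 ?divr_ge0 ?(ltW gt0') //.
by rewrite -[leRHS]invrK invf_div [X in _ <= X^-1]mulrC lef_pV2 ?posrE.
Qed.

Lemma natr_le1 (K : numFieldType) k : k.+1%:R^-1 <= 1 :> K.
Proof. by rewrite invf_le1 // ler1n. Qed.

Lemma inv_shift_pow_le (K : numFieldType) (c : K) p k : c <= 2^-1 ->
  ((k.+1%:R - c) ^+ p.+1)^-1 <= 2 ^+ p.+1 / k.+1%:R.
Proof.
move=> c_le; have /andP[_ /le_trans] := inv_shift_pow p.+1 k c_le; apply.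
rewrite exprMn ler_pM2l ?exprn_gt0 // exprS ler_piMr ?invr_ge0 //.
by rewrite exprn_ile1 ?invr_ge0 ?natr_le1.
Qed.

Lemma inv_shift_pow_le2 (K : numFieldType) (c : K) p k : c <= 2^-1 ->
  ((k.+1%:R - c) ^+ p.+2)^-1 <= 2 ^+ p.+2 / k.+1%:R ^+ 2.
Proof.
move=> c_le; have /andP[_ /le_trans] := inv_shift_pow p.+2 k c_le; apply.
rewrite exprMn ler_pM2l ?exprn_gt0 // -exprVn -addn2 exprD.
rewrite ler_piMl ?exprn_ge0 ?invr_ge0 //.
by rewrite exprn_ile1 ?invr_ge0 ?natr_le1.
Qed.

Lemma inv_shift_pow_decr (K : numFieldType) (c : K) p k : c <= 2^-1 ->
  ((k.+2%:R - c) ^+ p)^-1 <= ((k.+1%:R - c) ^+ p)^-1.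
Proof.
move=> c_le; have gt0 n : 0 < n.+1%:R - c.
  by apply: lt_le_trans (half_le_shift n c_le); rewrite mulr_gt0.
rewrite lef_pV2 ?posrE ?exprn_gt0 ?gt0 // lerXn2r ?nnegrE ?(ltW (gt0 _)) //.
by rewrite lerB // ler_nat.
Qed.

Lemma partial_sumS (K : numFieldType) (c : K) p z n :
  partial_sum c p z n.+1 = partial_sum c p z n + z ^+ n.+1 / (n.+1%:R - c) ^+ p.
Proof. by rewrite /partial_sum big_nat_recr. Qed.

(** Multiplying by [z - 1] turns the partial sums, up to one boundary term, into
    sums of the differences of the coefficients. *)
Lemma partial_sum_abel_step (K : numFieldType) (c : K) p z k :
  let b n := ((n.+1%:R - c) ^+ p)^-1 in
  let u n := (z - 1) * partial_sum c p z n - z ^+ n.+1 * b n in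
  u k.+1 - u k = z ^+ k.+2 * (b k - b k.+1).
Proof. by move=> b u; rewrite /u partial_sumS -/(b k) [z ^+ k.+2]exprS; ring. Qed.

Lemma norm_partial_sum_term (K : numFieldType) (c : K) p z n : c <= 2^-1 -> `|z| = 1 ->
  `|z ^+ n / (n.+1%:R - c) ^+ p| = ((n.+1%:R - c) ^+ p)^-1.
Proof.
move=> c_le z1; rewrite normrM normrX z1 expr1n mul1r ger0_norm //.
by apply: ltW; have /andP[] := inv_shift_pow p n c_le.
Qed.

Lemma telescope_inv_nat (K : numFieldType) k :
  k.+1%:R^-1 - k.+2%:R^-1 = (k.+1%:R * k.+2%:R)^-1 :> K.
Proof.
have -> : (k.+1%:R * k.+2%:R)^-1 = (k.+2%:R - k.+1%:R) / (k.+1%:R * k.+2%:R) :> K.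
  by rewrite -natrB // subSnn mul1r.
move: (k.+1%:R : K) (k.+2%:R : K) (pnatr_eq0 K k.+1) (pnatr_eq0 K k.+2) => a b a0 b0.
by field; rewrite a0 b0.
Qed.

(** One rate for all the series of the theorem.  If [z <> 1], summation by
    parts bounds [|z - 1|] times the tail by twice its first coefficient; if
    [z = 1], the exponent is at least 2 and the terms are dominated by a
    multiple of [1/k - 1/(k+1)]. *)
Lemma partial_sum_rate (R : realType) (c : R[i]) p (z : R[i]) : c <= 2^-1 ->
  `|z| = 1 -> ~ (p = 0%N /\ z = 1) ->
  exists L D, forall n, `|partial_sum c p.+1 z n - L| <= D / n.+1%:R.
Proof.
move=> c_le z1 pz.
pose b k := ((k.+1%:R - c) ^+ p.+1)^-1.
have b_ge0 k : 0 <= b k by apply: ltW; have /andP[] := inv_shift_pow p.+1 k c_le.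
have [z_eq1|z_neq1] := eqVneq z 1.
  case: p pz b {b_ge0} => [|p] pz b; first by case: pz.
  apply: (@cauchy_rate _ _ (2 ^+ p.+3)) => n m.
  have v_ge0 k : 0 <= 2 ^+ p.+3 / k.+1%:R :> R[i] by rewrite divr_ge0 ?exprn_ge0.
  have uv k : `|partial_sum c p.+2 z k.+1 - partial_sum c p.+2 z k|
      <= 2 ^+ p.+3 / k.+1%:R - 2 ^+ p.+3 / k.+2%:R.
    rewrite partial_sumS addrAC subrr add0r exprS -mulrA normrM z1 mul1r.
    rewrite norm_partial_sum_term //.
    apply: le_trans (inv_shift_pow_le2 p k c_le) _.
    rewrite -mulrBr telescope_inv_nat [2 ^+ p.+3]exprSr.
    rewrite -[leRHS]mulrA ler_pM2l ?exprn_gt0 //.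
    rewrite expr2 !invfM mulrCA ler_pM2l ?invr_gt0 //.
    rewrite ler_pdivlMr // ler_pdivrMl //.
    by rewrite -natrM ler_nat; lia.
  by move=> /(telescoping_bound uv) /le_trans; apply; rewrite gerBl.
pose u m := (z - 1) * partial_sum c p.+1 z m - z ^+ m.+1 * b m.
have uv k : `|u k.+1 - u k| <= b k - b k.+1.
  rewrite (partial_sum_abel_step c p.+1 z k).
  rewrite normrM normrX z1 expr1n mul1r ger0_norm // subr_ge0.
  exact: inv_shift_pow_decr.
have z1_gt0 : 0 < `|z - 1| by rewrite normr_gt0 subr_eq0.
apply: (@cauchy_rate _ _ (`|z - 1|^-1 * (2 * 2 ^+ p.+1))) => n m le_nm.
rewrite -mulrA -[leRHS]mulrC ler_pdivlMr // mulrC -normrM.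
have -> : (z - 1) * (partial_sum c p.+1 z m - partial_sum c p.+1 z n)
    = (u m - u n) + (z ^+ m.+1 * b m - z ^+ n.+1 * b n).
  by rewrite /u; ring.
have zb k : `|z ^+ k.+1 * b k| = b k.
  by rewrite normrM normrX z1 expr1n mul1r ger0_norm.
apply: le_trans (ler_normD _ _) _.
apply: le_trans (lerD (telescoping_bound uv le_nm) (ler_normB _ _)) _.
rewrite !zb addrA subrK -mulr2n -[b n *+ 2]mulr_natl -[leRHS]mulrA ler_pM2l //.
exact: inv_shift_pow_le.
Qed.

Lemma rate_tends (R : realType) (u : nat -> R[i]) L D :
  (forall n, `|u n - L| <= D / n.+1%:R) -> tends u L.
Proof.
move=> uL; apply: (@tends_bound _ _ _ D harmonic) => [|n]; first exact: cvg_harmonic.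
by apply: le_trans (uL n) _; rewrite fmorphV rmorph_nat.
Qed.

(** Replace the inner partial sum by its limit [tz].  What remains has terms of
    size [O(1/n) * O(1/n)], hence converges absolutely, even when [q + 1 = 1]. *)
Lemma T_partial_sum_cvg (R : realType) p q (z w : R[i]) :
  `|z| = 1 -> `|w| = 1 -> ~ (p = 0%N /\ z = 1) -> ~ (q = 0%N /\ w = 1) ->
  exists L, tends (T_partial_sum p.+1 q.+1 z w) L.
Proof.
move=> z1 w1 pz qw; have half_le := lexx (2^-1 : R[i]).
have [tz [D tzD]] := partial_sum_rate half_le z1 pz.
have [tw [E twE]] := partial_sum_rate half_le w1 qw.
have D_ge0 : 0 <= D by have := tzD 0%N; rewrite divr1; apply: le_trans.
pose err N := T_partial_sum p.+1 q.+1 z w N - tz * partial_sum 2^-1 q.+1 w N.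
have [e [F eF]] : exists e F, forall n, `|err n - e| <= F / n.+1%:R.
  apply: (@cauchy_rate _ _ (D * 2 ^+ q.+1)) => n m le_nm.
  have v_ge0 k : 0 <= D * 2 ^+ q.+1 / k.+1%:R by rewrite divr_ge0 ?mulr_ge0 ?exprn_ge0.
  apply: le_trans (telescoping_bound
    (v := fun k => D * 2 ^+ q.+1 / k.+1%:R) _ le_nm) _; last by rewrite gerBl.
  move=> k; have -> : err k.+1 - err k = (partial_sum 2^-1 p.+1 z k.+1 - tz)
      * (w * (w ^+ k / (k.+1%:R - 2^-1) ^+ q.+1)).
    rewrite /err partial_sumS /T_partial_sum big_nat_recr //= [w ^+ k.+1]exprS; ring.
  rewrite normrM normrM w1 mul1r norm_partial_sum_term //.
  have b_ge0 : 0 <= ((k.+1%:R - 2^-1) ^+ q.+1)^-1 :> R[i].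
    by apply: ltW; have /andP[] := inv_shift_pow q.+1 k half_le.
  have le_b := inv_shift_pow_le q k half_le.
  apply: le_trans (ler_pM (normr_ge0 _) b_ge0 (tzD k.+1) le_b) _.
  by rewrite -mulrBr telescope_inv_nat invfM mulrACA [k.+2%:R^-1 * _]mulrC.
exists (e + tz * tw).
apply: (tends_eq (tendsD (rate_tends eF) (tendsZ tz (rate_tends twE)))).
by move=> N; rewrite /err subrK.
Qed.

(** * Convolutions over a window *)

Lemma harmonic_convolution (K : numFieldType) N :
  \sum_(0 <= i < N) (i.+1%:R * (N - i)%:R)^-1
  = 2 / N.+1%:R * \sum_(0 <= i < N) i.+1%:R^-1 :> K.
Proof.
transitivity (\sum_(0 <= i < N) N.+1%:R^-1 * (i.+1%:R^-1 + (N - i)%:R^-1) : K).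
  apply: eq_big_nat => i /andP[_ lt_iN].
  have -> : N.+1%:R = i.+1%:R + (N - i)%:R :> K by rewrite -natrD; congr _%:R; lia.
  have : (N - i)%:R != 0 :> K by rewrite pnatr_eq0; lia.
  have : i.+1%:R != 0 :> K by rewrite pnatr_eq0.
  have : i.+1%:R + (N - i)%:R != 0 :> K by rewrite -natrD pnatr_eq0.
  move: (i.+1%:R : K) ((N - i)%:R : K) => a b ab0 a0 b0.
  by field; rewrite a0 b0 ab0.
rewrite -mulr_sumr big_split /= [X in _ + X]big_nat_rev /=.
rewrite [X in _ + X](_ : _ = \sum_(0 <= i < N) i.+1%:R^-1); last first.
  by apply: eq_big_nat => i lt_iN; congr (_%:R^-1); lia.
by ring.
Qed.

Lemma norm_half_odd_ge (K : numFieldType) n : 2^-1 <= `|half_odd K n|.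
Proof.
have -> : half_odd K n = 2^-1 * (n *+ 2 - 1)%:~R.
  by rewrite /half_odd rmorphB rmorphMn /=; field.
rewrite normrM gtr0_norm // -[leLHS]mulr1 ler_pM2l // -intr_norm.
by rewrite (_ : 1 = 1%:~R) // ler_int; lia.
Qed.

(** In terms of harmonic numbers this is [O(H_N / N)]: the positive half of the
    window has [i >= N], and the other half is a convolution of two harmonic
    sequences. *)
Lemma window_weight_bound (K : numFieldType) N :
  \sum_(0 <= i < N + N) (`|half_odd K (window N i)| * i.+1%:R)^-1
  <= 6 / N.+1%:R * \sum_(0 <= i < N) i.+1%:R^-1.
Proof.
pose F (n : int) : K := (`|half_odd K n| * (n + N)%:~R)^-1.
rewrite (eq_bigr (fun i => F (window N i))); last first.
  by move=> i _; rewrite /F (_ : window N i + N = i.+1) // /window; lia.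
rewrite big_window big_split /=.
(* 2 bounds the positive half of the window, 4 the other half. *)
have -> : 6 / N.+1%:R = 2 / N.+1%:R + 2 * (2 / N.+1%:R) :> K by ring.
have inv_ge0 i : 0 <= i%:R^-1 :> K by rewrite invr_ge0.
have abs_le i : `|i.+1%:R - 2^-1|^-1 <= 2 / i.+1%:R :> K.
  have /andP[gt0] := inv_shift_pow 1 i (lexx (2^-1 : K)).
  by move: gt0; rewrite !expr1 invr_gt0 => /gtr0_norm->.
rewrite mulrDl -mulrA -[X in _ <= _ + X]mulrA -harmonic_convolution.
apply: lerD; rewrite !mulr_sumr; apply: ler_sum_nat => i /andP[_ lt_iN].
  rewrite /F half_oddS (_ : (i.+1%:Z + N)%:~R = (i.+1 + N)%:R) //.
  have le_N : (i.+1 + N)%:R^-1 <= N.+1%:R^-1 :> K.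
    by rewrite lef_pV2 ?posrE ?ltr0n // ler_nat; lia.
  rewrite invfM (le_trans (ler_pM _ _ (abs_le i) le_N)) ?invr_ge0 //.
  by rewrite -!mulrA ler_pM2l // mulrC.
rewrite /F half_oddN normrN.
have -> : (- i%:Z + N)%:~R = (N - i)%:R :> K.
  by rewrite -[RHS]/((N - i)%:Z%:~R); congr _%:~R; lia.
by rewrite !invfM mulrA ler_wpM2r.
Qed.

Lemma window_weight_pow_bound (K : numFieldType) m N :
  \sum_(0 <= i < N + N) (`|half_odd K (window N i)| ^+ m.+1 * i.+1%:R)^-1
  <= 6 * 2 ^+ m / N.+1%:R * \sum_(0 <= i < N) i.+1%:R^-1.
Proof.
rewrite [6 * _]mulrC -!mulrA.
rewrite [_ * (_ * \sum_(_ <= _ < _) _)]mulrA.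
apply: le_trans (ler_wpM2l _ (window_weight_bound K N)); last exact: exprn_ge0.
rewrite mulr_sumr; apply: ler_sum_nat => i _.
rewrite exprSr !invfM mulrA ler_wpM2r ?invr_ge0 // ler_wpM2r ?invr_ge0 //.
rewrite -exprVn lerXn2r ?nnegrE ?invr_ge0 //.
have h := norm_half_odd_ge K (window N i).
by rewrite -[leRHS]invrK lef_pV2 ?posrE // (lt_le_trans _ h).
Qed.

(** A partial sum [r i] of variable length may be replaced by its limit [L]:
    the error is bounded by a multiple of a Cesaro mean of the harmonic
    sequence.  For [m = 0] the weights bounding [W] are not summable, but this
    mean still tends to 0. *)
Lemma window_convolution_tends (R : realType) m (W : nat -> nat -> R[i])
    (r : nat -> R[i]) (L D S : R[i]) :
  (forall N i, (i < N + N)%N ->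
     `|W N i| <= (`|half_odd R[i] (window N i)| ^+ m.+1)^-1) ->
  (forall i, `|r i - L| <= D / i.+1%:R) ->
  tends (fun N => \sum_(0 <= i < N + N) W N i) S ->
  tends (fun N => \sum_(0 <= i < N + N) W N i * r i) (S * L).
Proof.
move=> W_le rL WS.
have D_ge0 : 0 <= D by have := rL 0%N; rewrite divr1; apply: le_trans.
pose err N := \sum_(0 <= i < N + N) W N i * (r i - L).
suff err0 : tends err 0.
  rewrite -[S * L]add0r mulrC; apply: (tends_eq (tendsD err0 (tendsZ L WS))) => N.
  rewrite /err mulr_sumr -big_split /=; apply: eq_bigr => i _; ring.
apply: (@tends_bound _ _ _ (D * (6 * 2 ^+ m)) (arithmetic_mean harmonic)) => [|N].
  exact/cesaro/cvg_harmonic.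
have -> : (arithmetic_mean harmonic N)%:C
    = N.+1%:R^-1 * \sum_(0 <= i < N.+1) i.+1%:R^-1 :> R[i].
  rewrite /arithmetic_mean /series /= rmorphM fmorphV rmorph_nat rmorph_sum.
  by congr (_ * _); apply: eq_bigr => i _; rewrite /harmonic fmorphV rmorph_nat.
rewrite subr0 (le_trans (ler_norm_sum _ _ _)) //.
apply: (@le_trans _ _ (D * \sum_(0 <= i < N + N)
    (`|half_odd R[i] (window N i)| ^+ m.+1 * i.+1%:R)^-1)).
  rewrite mulr_sumr; apply: ler_sum_nat => i /andP[_ lt_i].
  by rewrite normrM invfM mulrCA ler_pM // W_le.
rewrite -mulrA ler_wpM2l // (le_trans (window_weight_pow_bound _ _ _)) // -mulrA.
rewrite ler_wpM2l ?mulr_ge0 ?exprn_ge0 // ler_wpM2l ?invr_ge0 //.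
by rewrite big_nat_recr //= lerDl invr_ge0.
Qed.

(** * Passage to the limit *)

Lemma unity_root_norm (R : realType) (z : R[i]) : some_unity_root z -> `|z| = 1.
Proof.
move=> [n n_gt0 /unity_rootP zn1]; apply: (@pexpIrn _ n) => //.
  by rewrite nnegrE.
by rewrite -normrX zn1 normr1 expr1n.
Qed.

Lemma norm_exprz1 (K : numFieldType) (x : K) (n : int) : `|x| = 1 -> `|x ^ n| = 1.
Proof.
move=> x1; case: n => n;
  by rewrite ?NegzE -?exprnN -?exprnP ?normfV normrX x1 expr1n ?invr1.
Qed.

Lemma partial_sum_ti_tends (R : realType) p (z : R[i]) :
  `|z| = 1 -> ~ (p = 0%N /\ z = 1) ->
  tends (partial_sum 2^-1 p.+1 z) (ti p.+1 z).
Proof.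
move=> z1 pz; have [L [D LD]] := partial_sum_rate (lexx _) z1 pz.
by have ut := rate_tends LD; rewrite /ti (sum_from1_tends ut).
Qed.

Lemma Li_rate (R : realType) p (z : R[i]) : `|z| = 1 -> ~ (p = 0%N /\ z = 1) ->
  exists D, forall n, `|partial_sum 0 p.+1 z n - Li p.+1 z| <= D / n.+1%:R.
Proof.
move=> z1 pz; have half_ge0 : 0 <= 2^-1 :> R[i] by rewrite invr_ge0.
have [L [D LD]] := partial_sum_rate half_ge0 z1 pz.
suff -> : Li p.+1 z = L by exists D.
apply: sum_from1_tends; apply: (tends_eq (rate_tends LD)) => N.
by apply: eq_bigr => k _; rewrite subr0.
Qed.

Lemma T_sum_tends (R : realType) p q (z w : R[i]) :
  `|z| = 1 -> `|w| = 1 -> ~ (p = 0%N /\ z = 1) -> ~ (q = 0%N /\ w = 1) ->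
  tends (T_partial_sum p.+1 q.+1 z w) (T_sum p.+1 q.+1 z w).
Proof.
move=> z1 w1 pz qw; have [L TL] := T_partial_sum_cvg z1 w1 pz qw.
by rewrite /T_sum (sum_from1_tends TL).
Qed.

Lemma inv_neq1 (K : fieldType) (n : nat) (z : K) :
  ~ (n = 0%N /\ z = 1) -> ~ (n = 0%N /\ z^-1 = 1).
Proof. by move=> nz [n0 /eqP]; rewrite invr_eq1 => /eqP z1; apply: nz. Qed.

(** The bilateral sum of [x^n / (half_odd n)^(m+1)], taken symmetrically.  When
    [m = 0] and [x = 1] its truncations vanish because [half_odd] is odd under
    [n -> 1 - n]; this is the value that the convention gives. *)
Lemma window_powersum_tends (R : realType) m (x : R[i]) : `|x| = 1 ->
  tends (fun N => \sum_(0 <= i < N + N)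
           x ^ window N i / half_odd R[i] (window N i) ^+ m.+1)
        ((-1) ^+ m * ti_diff m x).
Proof.
move=> x1; have x0 : x != 0 by rewrite -normr_eq0 x1 oner_eq0.
rewrite /ti_diff; case: ifPn => [/andP[/eqP-> /eqP->]|mx].
  rewrite mulr0; apply: (tends_eq (tends_cst 0)) => N.
  by rewrite window_powersum ?oner_eq0 // invr1 expr1 mulr1 mulN1r subrr.
have mx' : ~ (m = 0%N /\ x = 1) by move=> [m0 xe]; rewrite m0 xe !eqxx in mx.
have mxV := inv_neq1 mx'.
have xV1 : `|x^-1| = 1 by rewrite normfV x1 invr1.
have -> : (-1) ^+ m * ((-1) ^+ m * ti m.+1 x - x * ti m.+1 x^-1)
        = ti m.+1 x + (-1) ^+ m.+1 * x * ti m.+1 x^-1.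
  by rewrite mulrBr signrMK exprS mulN1r !mulNr mulrA.
have tx := partial_sum_ti_tends x1 mx'; have txV := partial_sum_ti_tends xV1 mxV.
apply: (tends_eq (tendsD tx (tendsZ _ txV))) => N.
by rewrite window_powersum.
Qed.

Lemma ti_diffVE (R : realType) m (x : R[i]) :
  ti_diffV m x = - ((-1) ^+ m * ti_diff m x).
Proof.
rewrite /ti_diffV /ti_diff; case: ifP => _; first by rewrite mulr0 oppr0.
by rewrite mulrBr signrMK opprB mulrA.
Qed.

Lemma left_products_tends (R : realType) m s (x z : R[i]) :
  `|x| = 1 -> `|z| = 1 -> ~ (s = 0%N /\ z = 1) ->
  tends (fun N => \sum_(0 <= j < N + N)
           x ^ window N j / half_odd R[i] (window N j) ^+ m.+1
             * partial_sum 0 s.+1 z j)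
        ((-1) ^+ m * ti_diff m x * Li s.+1 z).
Proof.
move=> x1 z1 sz; have [D LD] := Li_rate z1 sz.
apply: (@window_convolution_tends _ m
  (fun N j => x ^ window N j / half_odd R[i] (window N j) ^+ m.+1)
  (partial_sum 0 s.+1 z) _ D) => //; last exact: window_powersum_tends.
move=> N i _; have x0 : x != 0 by rewrite -normr_eq0 x1 oner_eq0.
by rewrite normrM normfV normrX norm_exprz1 // mul1r.
Qed.

Lemma window_rev N i : (i < N + N)%N ->
  window N (N + N - i.+1) = 1 - window N i.
Proof. by rewrite /window; lia. Qed.

(** Here the partial sums get shorter as the index grows; reversing the window
    brings them to increasing length and only replaces [half_odd] by its
    opposite. *)
Lemma right_products_tends (R : realType) m s (x z : R[i]) :
  `|x| = 1 -> `|z| = 1 -> ~ (s = 0%N /\ z = 1) ->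
  tends (fun N => \sum_(0 <= i < N + N)
           x ^ window N i / (- half_odd R[i] (window N i)) ^+ m.+1
             * partial_sum 0 s.+1 z ((N + N).-1 - i))
        (- ti_diff m x * Li s.+1 z).
Proof.
move=> x1 z1 sz; have [D LD] := Li_rate z1 sz.
pose W N i := x ^ window N (N + N - i.+1)
              / (- half_odd R[i] (window N (N + N - i.+1))) ^+ m.+1.
have W_le N i : (i < N + N)%N ->
    `|W N i| <= (`|half_odd R[i] (window N i)| ^+ m.+1)^-1.
  move=> lt_i; rewrite /W window_rev // half_oddC opprK normrM normfV normrX.
  by rewrite norm_exprz1 // mul1r.
have WS : tends (fun N => \sum_(0 <= i < N + N) W N i) (- ti_diff m x).
  have -> : - ti_diff m x = (-1) ^+ m.+1 * ((-1) ^+ m * ti_diff m x).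
    by rewrite exprS -mulrA [(-1) ^+ m * _]mulrA -expr2 sqrr_sign mul1r mulN1r.
  apply: (tends_eq (tendsZ _ (window_powersum_tends (m := m) x1))) => N.
  rewrite mulr_sumr [LHS]big_nat_rev; apply: eq_bigr => i _.
  rewrite /W add0n [(- half_odd _ _) ^+ m.+1]exprNn.
  by rewrite invfM inv_sign_pow mulrCA.
apply: (tends_eq (window_convolution_tends W_le LD WS)) => N.
rewrite [LHS]big_nat_rev; apply: eq_big_nat => i /andP[_ lt_i].
rewrite /W add0n (_ : (N + N - (N + N - i.+1).+1)%N = i); last by lia.
by congr (_ * partial_sum _ _ _ _); lia.
Qed.

Theorem theorem3p1 (R : realType) (x y : R[i]) (p q : nat)
    (hx : some_unity_root x) (hy : some_unity_root y)
    (hp : (1 <= p)%N) (hq : (1 <= q)%N)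
    (hpy : ~ (p = 1%N /\ y = 1)) (hqxy : ~ (q = 1%N /\ x * y = 1)) :
  x * T_sum p q y (x * y)^-1 - (-1) ^+ (p + q) * T_sum p q y^-1 (x * y)
  = x * ti p y * ti q (x * y)^-1
    + (-1) ^+ q * y^-1 * ti p y * ti q (x * y)
    + (-1) ^+ (p + q - 1) * ti (p + q) x
    + (-1) ^+ q * (\sum_(0 <= m < p)
        'C(p + q - m - 2, q - 1)%:R * ti_diff m x * Li (p + q - m - 1) (x * y))
    + (-1) ^+ q * (\sum_(0 <= m < q)
        'C(p + q - m - 2, p - 1)%:R * ti_diffV m x * Li (p + q - m - 1) y).
Proof.
have x1 := unity_root_norm hx; have y1 := unity_root_norm hy.
have xy1 : `|x * y| = 1 by rewrite normrM x1 y1 mulr1.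
have norm_inv z : `|z| = 1 -> `|z^-1| = 1 :> R[i].
  by move=> z1; rewrite normfV z1 invr1.
have norm_neq0 z : `|z| = 1 -> z != 0 :> R[i].
  by move=> z1; rewrite -normr_eq0 z1 oner_eq0.
case: p hp hpy => // p _ hpy; case: q hq hqxy => // q _ hqxy.
have py : ~ (p = 0%N /\ y = 1) by move=> [p0 y_1]; apply: hpy; rewrite p0.
have qxy : ~ (q = 0%N /\ x * y = 1) by move=> [q0 xy_1]; apply: hqxy; rewrite q0.
pose a m := 'C(p + q - m, q)%:R * (- ti_diff m x * Li (p + q - m).+1 (x * y)).
pose b m := 'C(p + q - m, p)%:R
  * ((-1) ^+ m * ti_diff m x * Li (p + q - m).+1 y).
pose A := \sum_(0 <= m < p.+1) a m; pose B := \sum_(0 <= m < q.+1) b m.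
have lim_pf : tends (window_sum p.+1 q.+1 x y) (A + B).
  apply: (tends_eq (tendsD
    (tends_sum (a := a) (fun m lt_m =>
       tendsZ _ (right_products_tends (m := m) x1 xy1 _)))
    (tends_sum (a := b) (fun m lt_m =>
       tendsZ _ (left_products_tends (m := m) x1 y1 _))))).
  - by move=> m lt_m [e xy_1]; apply: qxy; split => //; lia.
  - by move=> m lt_m [e y_1]; apply: py; split => //; lia.
  by move=> N; rewrite window_sum_partial_fractions ?norm_neq0.
have lim_split : tends (window_sum p.+1 q.+1 x y)
   ((-1) ^+ p.+1 * (T_sum p.+1 q.+1 y^-1 (x * y) - ti (p.+1 + q.+1) x)
  + y^-1 * (ti p.+1 y * ti q.+1 (x * y))
  + (-1) ^+ q.+1 * x * (ti p.+1 y * ti q.+1 (x * y)^-1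
                     - T_sum p.+1 q.+1 y (x * y)^-1)).
  have pqx : ~ ((p + q.+1)%N = 0%N /\ x = 1) by case; lia.
  have yV1 := norm_inv _ y1; have xyV1 := norm_inv _ xy1.
  have pyV := inv_neq1 py; have qxyV := inv_neq1 qxy.
  have tp := partial_sum_ti_tends y1 py.
  have tq := partial_sum_ti_tends xy1 qxy.
  have tqV := partial_sum_ti_tends xyV1 qxyV.
  have tx := partial_sum_ti_tends x1 pqx.
  have TV := T_sum_tends yV1 xy1 pyV qxy; have T := T_sum_tends y1 xyV1 py qxyV.
  apply: (tends_eq (tendsD (tendsD (tendsZ _ (tendsB TV tx))
    (tendsZ _ (tendsM tp tq))) (tendsZ _ (tendsB (tendsM tp tqV) T)))).
  by move=> N; rewrite window_sum_split ?norm_neq0.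
have AB := tends_unique lim_pf lim_split.
rewrite (eq_big_nat _ _ (F2 := fun m => - a m)); last first.
  move=> m /andP[_ lt_m].
  rewrite (_ : (p.+1 + q.+1 - m - 2)%N = (p + q - m)%N); last by lia.
  rewrite (_ : (p.+1 + q.+1 - m - 1)%N = (p + q - m).+1); last by lia.
  by rewrite subn1 /= /a mulNr mulrN opprK mulrA.
rewrite [X in _ + _ * X](eq_big_nat _ _ (F2 := fun m => - b m)); last first.
  move=> m /andP[_ lt_m].
  rewrite (_ : (p.+1 + q.+1 - m - 2)%N = (p + q - m)%N); last by lia.
  rewrite (_ : (p.+1 + q.+1 - m - 1)%N = (p + q - m).+1); last by lia.
  by rewrite ti_diffVE subn1 /= /b mulrN mulNr mulrA.
rewrite !sumrN -/A -/B.
have -> : A = (A + B) - B by ring.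
rewrite AB (_ : (p.+1 + q.+1 - 1)%N = (p.+1 + q)%N); last by lia.
rewrite !exprD [(-1) ^+ q.+1]exprS.
have sq : (-1) ^+ q * (-1) ^+ q = 1 :> R[i] by rewrite -expr2 sqrr_sign.
move: sq; set e := (-1) ^+ q; set f := (-1) ^+ p.+1 => sq.
(* The terms brought in by [A + B] carry [(-1)^q] squared: write it for the
   coefficient 1 of the terms they cancel. *)
rewrite !mulN1r -[x * T_sum _ _ _ _]mul1r -[x * ti _ _ * ti _ (x * y)^-1]mul1r -sq.
ring.
Qed.
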